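(* Let $\Gamma\in\mathbf R^{N\times N}$ be any outer coupling matrix such that the sum of every row of $\Gamma$ is $0$, or the sum of every column of $\Gamma$ is $0$. If the network $$\dot x=(I_N\otimes A_1+\Gamma\otimes A_{12})x+(E_N\otimes B_1)w_1,\qquad y=(E_N^T\otimes C_1)x$$ is stable (i.e. $I_N\otimes A_1+\Gamma\otimes A_{12}$ is stable), then its $H_2$ norm is $\gamma_2N$, where $\gamma_2$ is the $H_2$ norm of the single-node system $\dot\xi=A_1\xi+B_1w_1,\ y_1=C_1\xi$.
   Context: $A_1\in\mathbf R^{n\times n}$, $B_1\in\mathbf R^{n\times m}$, $C_1\in\mathbf R^{m\times n}$ are constant matrices and $A_{12}=B_1C_1$. $\otimes$ is the Kronecker product, $I_N$ the identity matrix, $E_N=(1,\dots,1)^T\in\mathbf R^N$. A square matrix is stable if all its eigenvalues have negative real part. The $H_2$ norm of a system $\dot\xi=A\xi+Bw,\ y=C\xi$ with $A$ stable is that of its transfer function $G(s)=C(sI-A)^{-1}B$, namely $\|G\|_2=\sqrt{\frac1{2\pi}\int_{-\infty}^{\infty}\mathrm{trace}\{G(j\omega)^HG(j\omega)\}\,d\omega}$. *)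

(* Defs.v *)
From mathcomp Require Import all_boot all_order all_algebra.
From mathcomp Require Import complex mxtens.
From mathcomp Require Import all_classical all_reals all_analysis.

Set Implicit Arguments.
Unset Strict Implicit.
Unset Printing Implicit Defensive.

Import Order.TTheory GRing.Theory Num.Theory.

Local Open Scope ring_scope.
Local Open Scope sesquilinear_scope.

Definition complexmx (R : realType) (p q : nat) (M : 'M[R]_(p, q)) :
    'M[R[i]]_(p, q) :=
  map_mx (real_complex R) M.

(* The eigenvalues of a real matrix are taken over the complex numbers. *)
Definition stable (R : realType) (n : nat) (A : 'M[R]_n) : Prop :=
  forall z : R[i], eigenvalue (complexmx A) z -> complex.Re z < 0.

(* [invmx] is the identity on singular matrices, so the value is meaningful
   only when [s] is not an eigenvalue of [A]; if [A] is stable this covers the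
   whole imaginary axis. *)
Definition transfer (R : realType) (n m p : nat) (A : 'M[R]_n)
    (B : 'M[R]_(n, m)) (C : 'M[R]_(p, n)) (s : R[i]) : 'M[R[i]]_(p, m) :=
  complexmx C *m invmx (s%:M - complexmx A) *m complexmx B.

(* The trace is a nonnegative real element of [R[i]], so [complex.Re] only casts
   it to [R]. The norm lives in [\bar R] so that a divergent integral yields
   [+oo] instead of a default real value. *)
Definition h2norm (R : realType) (n m p : nat) (A : 'M[R]_n)
    (B : 'M[R]_(n, m)) (C : 'M[R]_(p, n)) : \bar R :=
  let G (w : R) := transfer A B C (0 +i* w)%C in
  sqrte ((2 * pi)^-1%:E *
    \int[@lebesgue_measure R]_w (complex.Re (\tr ((G w)^t* *m G w)))%:E)%E.

Definition ones (R : realType) (N : nat) : 'cV[R]_N := const_mx 1.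

Definition networkA (R : realType) (N n m : nat) (G : 'M[R]_N) (A1 : 'M[R]_n)
    (B1 : 'M[R]_(n, m)) (C1 : 'M[R]_(m, n)) : 'M[R]_(N * n) :=
  1%:M *t A1 + G *t (B1 *m C1).

Definition networkB (R : realType) (N n m : nat) (B1 : 'M[R]_(n, m)) :
    'M[R]_(N * n, 1 * m) :=
  ones R N *t B1.

Definition networkC (R : realType) (N n m : nat) (C1 : 'M[R]_(m, n)) :
    'M[R]_(1 * m, N * n) :=
  (ones R N)^T *t C1.

(* Main.v *)
Require Import Defs.
From mathcomp Require Import all_boot all_order all_algebra.
From mathcomp Require Import complex mxtens.
From mathcomp Require Import all_classical all_reals all_analysis.

(** With [E] the all-ones column, a row-sum-zero [G] satisfies [G E = 0], so
    [(s I - A)(E (x) I) = E (x) (s I - A1)] for the network matrix [A]; column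
    sums give the transposed identity. Inverting, the network transfer function
    is [E^T E = N] times that of a single node, so its squared norm is scaled
    by [N ^ 2]. *)

Import Order.TTheory GRing.Theory Num.Theory.

Local Open Scope ring_scope.
Local Open Scope sesquilinear_scope.

Lemma tensmxBr (F : comPzRingType) m n p q (A : 'M[F]_(m, n))
    (B C : 'M[F]_(p, q)) : A *t (B - C) = A *t B - A *t C.
Proof. by apply/matrixP => i j; rewrite !mxE mulrBr. Qed.

Lemma tensmxZr (F : comPzRingType) m n p q (c : F) (A : 'M[F]_(m, n))
    (B : 'M[F]_(p, q)) : A *t (c *: B) = c *: (A *t B).
Proof. by apply/matrixP => i j; rewrite !mxE mulrCA. Qed.

Lemma mxtrace_tens (F : comPzRingType) m n (A : 'M[F]_m) (B : 'M[F]_n) :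
  \tr (A *t B) = \tr A * \tr B.
Proof. by rewrite /mxtrace mulr_sum; apply: eq_bigr => i _; rewrite mxE. Qed.

Lemma unitmx_cast (F : comUnitRingType) m n (e : m = n) (A : 'M[F]_m) :
  (castmx (e, e) A \in unitmx) = (A \in unitmx).
Proof. by case: n / e. Qed.

Lemma castmx1 (F : pzRingType) m n (e : m = n) :
  castmx (e, e) 1%:M = 1%:M :> 'M[F]_n.
Proof. by case: n / e. Qed.

(** Since [M] intertwines [E *t 1%:M] with [P], [invmx M] intertwines it with [invmx P]; the
    remaining scalar is [E^T *m E]. Invertibility is assumed for [M] only and is inherited by
    [P]. *)
Lemma tens_ones_sandwich_r (F : fieldType) N n (M : 'M[F]_(N * n))
    (P : 'M[F]_n) (E : 'cV[F]_N := const_mx 1) :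
  (0 < N)%N -> M \in unitmx -> M *m (E *t 1%:M) = E *t P ->
  (E^T *t 1%:M) *m invmx M *m (E *t 1%:M) = (N%:R : F)%:M *t invmx P.
Proof.
case: N M @E => // N M E _ uM ME.
have E1 : E *t 1%:M = invmx M *m (E *t P) by rewrite -ME mulKmx.
(* Positivity of [N] enters here: [E] has a left inverse, the first basis row. *)
have d1 : (delta_mx 0 0 : 'rV_N.+1) *m E = 1%:M :> 'M[F]_1.
  by rewrite -rowE; apply/matrixP => i j; rewrite !mxE !ord1 eqxx.
have d2 : E^T *m E = N.+1%:R%:M.
  apply/matrixP => i j; rewrite !ord1 !mxE (eq_bigr (fun=> 1)).
    by rewrite sumr_const card_ord eqxx mulr1n.
  by move=> k _; rewrite !mxE mulr1.
(* Compressing [invmx M] to the first block yields a left inverse of [P]. *)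
have uP : P \in unitmx.
  suff: (1%:M : 'M[F]_1) *t P \in unitmx by rewrite tens_scalar1mx unitmx_cast.
  suff /mulmx1_unit[] : ((delta_mx 0 0 : 'rV[F]_N.+1) *t 1%:M) *m invmx M *m
      (E *t 1%:M) *m ((1%:M : 'M[F]_1) *t P) = 1%:M by [].
  rewrite -!mulmxA tensmx_mul mulmx1 mul1mx -E1 tensmx_mul mulmx1 d1.
  by rewrite tens_scalar1mx castmx1.
rewrite -mulmxA.
have -> : invmx M *m (E *t 1%:M) = E *t invmx P.
  have -> : E *t 1%:M = M *m (E *t invmx P).
    rewrite -[invmx P]mul1mx -[E in RHS]mulmx1 -tensmx_mul mulmxA ME.
    by rewrite tensmx_mul mulmx1 mulmxV.
  by rewrite mulKmx.
by rewrite tensmx_mul mul1mx d2.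
Qed.

(** Transposition exchanges the two intertwining relations and keeps the shape of the sandwich, so
    this is the previous case for [M^T] and [P^T]. *)
Lemma tens_ones_sandwich_l (F : fieldType) N n (M : 'M[F]_(N * n))
    (P : 'M[F]_n) (E : 'cV[F]_N := const_mx 1) :
  (0 < N)%N -> M \in unitmx -> (E^T *t 1%:M) *m M = E^T *t P ->
  (E^T *t 1%:M) *m invmx M *m (E *t 1%:M) = (N%:R : F)%:M *t invmx P.
Proof.
move=> N0 uM EM; apply: trmx_inj.
rewrite !trmx_mul !trmx_tens !trmx1 trmxK !trmx_inv tr_scalar_mx mulmxA.
apply: tens_ones_sandwich_r; rewrite ?unitmx_tr//.
by rewrite -[M^T *m _]trmxK trmx_mul trmxK trmx_tens trmx1 EM trmx_tens trmxK.
Qed.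

(* [f] need not be measurable, unlike in [ge0_integralZl]: scaling by [k]
   permutes the simple functions over which the supremum is taken. *)
Lemma ge0_integralZl_gt0 d (T : measurableType d) (R : realType)
    (mu : {measure set T -> \bar R}) (f : T -> \bar R) (k : R) :
  (forall x, 0 <= f x)%E -> 0 < k ->
  (\int[mu]_x (k%:E * f x) = k%:E * \int[mu]_x f x)%E.
Proof.
move=> f0 k0.
have le c (h : T -> \bar R) : (forall x, 0 <= h x)%E -> 0 < c ->
    (c%:E * \int[mu]_x h x <= \int[mu]_x (c%:E * h x))%E.
  move=> h0 c0; rewrite !ge0_integralTE//; last first.
    by move=> x; rewrite mule_ge0// lee_fin ltW.
  rewrite -lee_pdivlMl//; apply: ge_ereal_sup => _ [p ph <-].
  rewrite lee_pdivlMl// -sintegralrM; apply: ereal_sup_ubound.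
  exists (scale_nnsfun p (ltW c0)) => // x /=.
  by rewrite EFinM lee_wpmul2l// lee_fin ltW.
apply/eqP; rewrite eq_le le// andbT.
(* The reverse inequality is [le] again, for the factor [k^-1] and the function [k * f]. *)
rewrite -lee_pdivrMl//.
apply: le_trans (le k^-1 _ _ _) _; rewrite ?invr_gt0//.
  by move=> x; rewrite mule_ge0// lee_fin ltW.
by under eq_integral do rewrite muleA -EFinM mulVf ?gt_eqF// mul1e.
Qed.

Lemma mulmx_adj_trace_ge0 (R : realType) m n (A : 'M[R[i]]_(m, n)) :
  0 <= \tr (A^t* *m A).
Proof.
rewrite /mxtrace; apply: sumr_ge0 => i _; rewrite mxE; apply: sumr_ge0 => j _.
by rewrite !mxE mulrC mul_conjC_ge0.
Qed.

(** A singular matrix here would make [i w], whose real part is zero, an eigenvalue. *)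
Lemma stable_resolvent_unit (R : realType) n (A : 'M[R]_n) (w : R) :
  stable A -> (0 +i* w)%C%:M - complexmx A \in unitmx.
Proof.
move=> sA; apply: contraT => nu.
have /sA : eigenvalue (complexmx A) (0 +i* w)%C.
  rewrite /eigenvalue /eigenspace kermx_eq0 row_free_unit.
  move: nu; apply: contra => u.
  by rewrite -opprB -scaleN1r unitmxZ// unitrN unitr1.
by rewrite /= ltxx.
Qed.

(** Input and output matrices factor through [E *t 1%:M] and its transpose, which leaves the
    resolvent in a sandwich. The scalar [N] is kept as a 1 x 1 Kronecker factor to match the
    dimensions [1 * m]. *)
Lemma transfer_network (R : realType) (N n m : nat) (A1 : 'M[R]_n)
    (B1 : 'M[R]_(n, m)) (C1 : 'M[R]_(m, n)) (G : 'M[R]_N) (s : R[i]) :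
  (0 < N)%N ->
  (forall i, \sum_j G i j = 0) \/ (forall j, \sum_i G i j = 0) ->
  s%:M - complexmx (networkA G A1 B1 C1) \in unitmx ->
  transfer (networkA G A1 B1 C1) (networkB N B1) (networkC N C1) s =
  (N%:R%:M : 'M[R[i]]_1) *t transfer A1 B1 C1 s.
Proof.
move=> N0 hG uM.
pose E : 'cV[R[i]]_N := const_mx 1.
have cE : map_mx (real_complex R) (ones R N) = E.
  by apply/matrixP => i j; rewrite !mxE rmorph1.
have cA : complexmx (networkA G A1 B1 C1) =
    1%:M *t complexmx A1 + complexmx G *t complexmx (B1 *m C1).
  by rewrite /complexmx /networkA map_mxD !map_mxT map_mx1.
have cB : complexmx (networkB N B1) = (E *t 1%:M) *m (1%:M *t complexmx B1).
  by rewrite /complexmx /networkB map_mxT cE tensmx_mul mulmx1 mul1mx.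
have cC : complexmx (networkC N C1) = (1%:M *t complexmx C1) *m (E^T *t 1%:M).
  by rewrite /complexmx /networkC map_mxT -map_trmx cE tensmx_mul mulmx1 mul1mx.
rewrite /transfer cB cC -!mulmxA.
rewrite [(E^T *t _) *m _]mulmxA [((E^T *t _) *m _) *m _]mulmxA.
have -> : (E^T *t 1%:M) *m invmx (s%:M - complexmx (networkA G A1 B1 C1)) *m
    (E *t 1%:M) = (N%:R : R[i])%:M *t invmx (s%:M - complexmx A1).
  case: hG => hG.
    apply: tens_ones_sandwich_r => //.
    have GE : complexmx G *m E = 0.
      apply/matrixP => i j; rewrite !mxE.
      rewrite (eq_bigr (fun k => real_complex R (G i k))); last first.
        by move=> k _; rewrite !mxE mulr1.
      by rewrite -rmorph_sum (hG i) rmorph0.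
    rewrite cA mulmxBl mulmxDl !tensmx_mul !mul1mx !mulmx1 GE tens0mx addr0.
    by rewrite mul_scalar_mx -tensmxZr scalemx1 tensmxBr.
  apply: tens_ones_sandwich_l => //.
  have EG : E^T *m complexmx G = 0.
    apply/matrixP => i j; rewrite !mxE.
    rewrite (eq_bigr (fun k => real_complex R (G k j))); last first.
      by move=> k _; rewrite !mxE mul1r.
    by rewrite -rmorph_sum (hG j) rmorph0.
  rewrite cA mulmxBr mulmxDr !tensmx_mul !mul1mx !mulmx1 EG tens0mx addr0.
  by rewrite mul_mx_scalar -tensmxZr scalemx1 tensmxBr.
by rewrite !tensmx_mul mulmx1 mul1mx mulmxA.
Qed.

Theorem corollary3 (R : realType) (N n m : nat) (A1 : 'M[R]_n)
    (B1 : 'M[R]_(n, m)) (C1 : 'M[R]_(m, n)) (G : 'M[R]_N)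
    (hG : (forall i : 'I_N, \sum_(j < N) G i j = 0) \/
          (forall j : 'I_N, \sum_(i < N) G i j = 0))
    (hstable : stable (networkA G A1 B1 C1)) :
  h2norm (networkA G A1 B1 C1) (networkB N B1) (networkC N C1)
  = (h2norm A1 B1 C1 * (N%:R)%:E)%E.
Proof.
have [N0|N0] := posnP N.
  (* With no nodes the state space is trivial and the transfer function is an empty sum. The right
     side is [0] even if the norm of the node is [+oo], by the convention [+oo * 0 = 0]. *)
  subst N; rewrite mule0 /h2norm (eq_integral (cst 0%E)).
    by rewrite integral0 mule0 sqrte0.
  move=> w _; congr EFin.
  suff -> : transfer (networkA G A1 B1 C1) (networkB 0 B1) (networkC 0 C1)
    (0 +i* w)%C = 0 by rewrite mulmx0 mxtrace0.
  by rewrite /transfer; apply/matrixP => i j; rewrite !mxE big1// => -[].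
rewrite /h2norm.
set g := fun w => complex.Re (\tr ((transfer A1 B1 C1 (0 +i* w)%C)^t* *m
  transfer A1 B1 C1 (0 +i* w)%C)).
have g0 w : 0 <= g w.
  have := mulmx_adj_trace_ge0 _ _ _ (transfer A1 B1 C1 (0 +i* w)%C).
  (* The order on [R[i]] compares real parts and requires equal imaginary parts. *)
  by rewrite lecE => /andP[].
transitivity (sqrte ((2 * pi)^-1%:E *
    \int[@lebesgue_measure R]_w ((N%:R ^+ 2)%:E * (g w)%:E))%E).
  congr (sqrte (_ * _)%E); apply: eq_integral => w _.
  rewrite transfer_network//; last exact: stable_resolvent_unit.
  rewrite -EFinM; congr EFin; rewrite /g.
  set T := transfer A1 B1 C1 _.
  (* The trace is multiplicative over [*t]; the 1 x 1 factor, real and hence self-adjoint,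
     contributes [N * N]. *)
  rewrite trmx_tens map_mxT tensmx_mul mxtrace_tens tr_scalar_mx map_scalar_mx.
  rewrite -scalar_mxM mxtrace_scalar mulr1n /= conjC_nat -natrM mulnn.
  by rewrite mulr_natl raddfMn /= -natrX mulr_natl.
have k0 : 0 < N%:R ^+ 2 :> R by rewrite exprn_gt0 ?ltr0n.
have fg0 w : (0 <= (g w)%:E)%E by rewrite lee_fin.
rewrite ge0_integralZl_gt0 //.
rewrite muleCA sqrteM; last by rewrite lee_fin ltW.
by rewrite muleC EFin_expe sqrte_sqr gee0_abs ?lee_fin.
Qed.
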